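(* Let $G$ be an infinite abelian squareful group. Then for every index set $I$ (in any ordered field $\mathbb{F}$) with $|I|=|G|$, $G$ has a directed $T_\infty$-terrace for $I$.
   Context: An infinite group $G$ is squareful if $|\{g^2:g\in G\}|=|G|$. Let $\mathbb{F}$ be an ordered field and $I\subseteq\mathbb{F}$; for $d\in\mathbb{F}^+$ put $I_{(d)}=\{i\in I:i+d\in I\}$. $I$ is an index set if $|I|=|\mathbb{F}|$ and for every $d\in\mathbb{F}^+$ either $|I_{(d)}|=|\mathbb{F}|$ or $I_{(d)}=\emptyset$. A bijection $\mathbf a:I\to G$ is a directed $T_\infty$-terrace for $G$ if for every $d\in\mathbb{F}^+$ with $I_{(d)}\ne\emptyset$ the map $\mathbf a_{(d)}:I_{(d)}\to G\setminus\{e\}$, $\mathbf a_{(d)}(i)=\mathbf a(i)^{-1}\mathbf a(i+d)$, is a bijection. *)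

(* Defs.v *)
From mathcomp Require Import all_boot all_order all_algebra.
From mathcomp Require Import boolp classical_sets functions cardinality.

Set Implicit Arguments.
Unset Strict Implicit.
Unset Printing Implicit Defensive.

Local Open Scope classical_set_scope.
Local Open Scope card_scope.
Local Open Scope ring_scope.

Definition abelian_group (G : groupType) : Prop := forall x y : G, commute x y.

Definition squareful (G : groupType) : Prop :=
  infinite_set [set: G] /\ [set (g ^+ 2)%g | g in [set: G]] #= [set: G].

Definition shift_set (F : realFieldType) (I : set F) (d : F) : set F :=
  [set i | I i /\ I (i + d)].

Definition index_set (F : realFieldType) (I : set F) : Prop :=
  I #= [set: F] /\
  forall d : F, 0 < d ->
    shift_set I d #= [set: F] \/ shift_set I d = set0.

Definition step (F : realFieldType) (G : groupType) (a : F -> G) (d : F) :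
    F -> G :=
  fun i => ((a i)^-1 * a (i + d)%R)%g.

(* The values of a outside I are irrelevant: a bijection I -> G is a total
   function whose restriction to I is one. *)
Definition directed_terrace (F : realFieldType) (G : groupType) (I : set F)
    (a : F -> G) : Prop :=
  set_bij I [set: G] a /\
  forall d : F, 0 < d -> shift_set I d <> set0 ->
    set_bij (shift_set I d) [set~ 1%g] (step a d).

(* Main.v *)
Require Import Defs.
From HB Require Import structures.
From mathcomp Require Import all_boot all_order all_algebra.
From mathcomp Require Import boolp classical_sets functions cardinality wochoice.

(* The graph of a directed T_oo-terrace is a set P of pairs in F * G, bijective
   onto I and G, in which every nonzero difference occurs at most once (a Sidon
   set: x + w = y + z forces x = y or x = z) and every (d, g) with I_(d)
   nonempty and g <> e does occur.  P is built by transfinite recursion along a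
   well order whose initial segments are smaller than G: each requirement (i in
   the domain, g in the range, (d, g) a difference) is met by adding at most two
   points.  Fewer than |G| values are forbidden for the free coordinates.  The
   only forbidden values not given by a linear equation come from x + x in a
   small set; squarefulness provides |G| elements with distinct squares. *)

Set Implicit Arguments.
Unset Strict Implicit.
Unset Printing Implicit Defensive.

Import Order.TTheory GRing.Theory Num.Theory.

Local Open Scope classical_set_scope.
Local Open Scope card_scope.

(** * Cardinal comparison *)

(** Working with a relation avoids having to give a total function [T -> U], which may not exist
    when [U] is empty; choice is applied with values in [option U] instead. *)
Lemma card_le_rel (T U : Type) (A : set T) (B : set U) (R : T -> U -> Prop) :
  (forall x, A x -> exists2 y, B y & R x y) ->
  (forall x x' y, A x -> A x' -> R x y -> R x' y -> x = x') ->
  A #<= B.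
Proof.
move=> totR injR.
have /choice[f fP] : forall x, exists o : option U, A x ->
    exists y, [/\ B y, R x y & o = Some y].
  move=> x; have [Ax|nAx] := pselect (A x); last by exists None.
  by have [y By Rxy] := totR x Ax; exists (Some y) => _; exists y.
rewrite -card_le_some; apply: card_le_trans (subset_card_le (A := f @` A) _).
  have /card_eqPle[//] : A #= f @` A.
  apply/card_esym/inj_card_eq => x x' /set_mem Ax /set_mem Ax' e.
  have [y [_ Rxy fx]] := fP x Ax; have [y' [_ Rxy' fx']] := fP x' Ax'.
  have yy' : y = y' by apply: Some_inj; rewrite -fx -fx'.
  by apply: (injR _ _ y) => //; rewrite yy'.
by move=> _ [x Ax <-]; have [y [By _ ->]] := fP x Ax; exists y.
Qed.

(** Zorn's lemma gives a maximal graph of a partial injection from [A] to [B]. If it missed a point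
    on each side, that pair could be added. *)
Lemma card_le_total (T U : Type) (A : set T) (B : set U) :
  A #<= B \/ B #<= A.
Proof.
pose P (R : set (T * U)) := R `<=` A `*` B /\
  forall p q, R p -> R q -> (p.1 = q.1 -> p = q) /\ (p.2 = q.2 -> p = q).
have [|R [[RAB Rbij] maxR]] := @Zorn_bigcup _ P.
  move=> C CP totC; split; first by move=> p [R /CP[+ _]]; apply.
  move=> p q [R CR Rp] [S CS Sq].
  have [RS|SR] := totC R S CR CS.
    by have [_ h] := CP S CS; apply: h => //; apply: RS.
  by have [_ h] := CP R CR; apply: h => //; apply: SR.
have [domR|] := pselect (forall x, A x -> exists2 y, B y & R (x, y)).
  left; apply: (@card_le_rel _ _ _ _ (fun x y => R (x, y))) => // x x' y _ _ r r'.
  by have [_ /(_ erefl)[]] := Rbij _ _ r r'.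
move=> /existsNP[x /not_implyP[Ax nx]].
have [ranR|] := pselect (forall y, B y -> exists2 x, A x & R (x, y)).
  right; apply: (@card_le_rel _ _ _ _ (fun y x => R (x, y))) => // y y' z _ _ r r'.
  by have [/(_ erefl)[]] := Rbij _ _ r r'.
move=> /existsNP[y /not_implyP[By ny]].
case: (maxR (R `|` [set (x, y)])).
  split; last by move=> h; apply: nx; exists y => //; apply: h; right.
  by move=> p Rp; left.
split=> [p [/RAB//|->//]|].
have nR p : R p -> p.1 <> x /\ p.2 <> y.
  case: p => u v Ruv; have [Au Bv] := RAB _ Ruv.
  by split=> e; [apply: nx; exists v | apply: ny; exists u] => //; rewrite -e.
move=> p q [Rp|->] [Rq|->] //=; first exact: Rbij.
- by have [? ?] := nR p Rp.
- by have [h1 h2] := nR q Rq; split=> /esym.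
Qed.

Lemma card_leX (T T' U U' : Type) (A : set T) (B : set T') (C : set U)
    (D : set U') :
  A #<= C -> B #<= D -> A `*` B #<= C `*` D.
Proof.
elim/Ppointed: U => U in C *.
  by rewrite !emptyE => -> _; rewrite set0X; apply: card_ge0.
elim/Ppointed: U' => U' in D *.
  by rewrite !emptyE => _ ->; rewrite setX0; apply: card_ge0.
move=> /pcard_leP/injfunPex[f fAC finj] /pcard_leP/injfunPex[g gBD ginj].
apply/pcard_leP/injfunPex; exists (fun p => (f p.1, g p.2)).
  by move=> p [Ap Bp]; split; [apply: fAC | apply: gBD].
move=> [x y] [x' y'] /set_mem[/= Ax By] /set_mem[/= Ax' By'] [].
move=> /(finj _ _ (mem_set Ax) (mem_set Ax')) ->.
by move=> /(ginj _ _ (mem_set By) (mem_set By')) ->.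
Qed.

(** The Boolean tag records which of the two injections is used. *)
Lemma card_leU (T U : Type) (A B : set T) (C : set U) :
  A #<= C -> B #<= C -> A `|` B #<= C `*` [set: bool].
Proof.
elim/Ppointed: U => U in C *.
  by rewrite !emptyE => -> ->; rewrite setU0; apply: card_ge0.
move=> /pcard_leP/injfunPex[f fAC finj] /pcard_leP/injfunPex[g gBC ginj].
apply: (@card_le_rel _ _ _ _ (fun x p =>
  if p.2 then A x /\ f x = p.1 else B x /\ g x = p.1)).
  move=> x [Ax|Bx]; first by exists (f x, true) => //; split=> //; apply: fAC.
  by exists (g x, false) => //; split=> //; apply: gBC.
move=> x x' [y []] _ _ /= [hx <-] [hx' e].
  by apply: finj => //; apply: mem_set.
by apply: ginj => //; apply: mem_set.
Qed.

(* Maximal injections [A `*` A -> A] with [A `<=` X], coded by their graphs. *)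
Lemma card_le_setXX (T : Type) (X : set T) :
  infinite_set X -> X `*` X #<= X.
Proof.
elim/Ppointed: T => T in X *.
  by rewrite emptyE => /(_ (@finite_set0 _)).
move=> infX.
(* The set [A] is read off the diagonal of the graph, so that Zorn's lemma applies to the graphs
   alone. *)
pose fld (R : set (T * T * T)) : set T := [set x | exists z, R (x, x, z)].
pose P (R : set (T * T * T)) :=
  [/\ fld R `<=` X,
      forall x y z, R (x, y, z) -> [/\ fld R x, fld R y & fld R z],
      forall x y, fld R x -> fld R y -> exists z, R (x, y, z) &
      forall p q, R p -> R q -> (p.1 = q.1 -> p = q) /\ (p.2 = q.2 -> p = q)].
have fldS R S : R `<=` S -> fld R `<=` fld S.
  by move=> RS x [z Rz]; exists z; apply: RS.
have [|R [[RX Rfld Rtot Rbij] maxR]] := @Zorn_bigcup _ P.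
  move=> C CP totC.
  have fldU x : fld (\bigcup_(S in C) S) x -> exists2 S, C S & fld S x.
    by move=> [z [S CS Sz]]; exists S => //; exists z.
  split.
  - by move=> x /fldU[S /CP[+ _ _ _]]; apply.
  - move=> x y z [S CS Sxyz]; have [_ /(_ _ _ _ Sxyz)[]] := CP S CS.
    by move=> *; split; apply: (@fldS S) => //; apply: bigcup_sup.
  - move=> x y /fldU[S CS Sx] /fldU[S' CS' Sy].
    have [SS|SS] := totC S S' CS CS'.
      have [_ _ h _] := CP S' CS'.
      by have [z ?] := h x y (fldS _ _ SS _ Sx) Sy; exists z; exists S'.
    have [_ _ h _] := CP S CS.
    by have [z ?] := h x y Sx (fldS _ _ SS _ Sy); exists z; exists S.
  - move=> p q [S CS Sp] [S' CS' Sq].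
    have [SS|SS] := totC S S' CS CS'.
      by have [_ _ _ h] := CP S' CS'; apply: h => //; apply: SS.
    by have [_ _ _ h] := CP S CS; apply: h => //; apply: SS.
set A := fld R in RX Rfld Rtot.
have AA : A `*` A #<= A.
  apply: (@card_le_rel _ _ _ _ (fun p z => R (p, z))).
    move=> [x y] [/= Ax Ay]; have [z Rz] := Rtot _ _ Ax Ay.
    by exists z => //; have [] := Rfld _ _ _ Rz.
  by move=> p p' z _ _ r r'; have [_ /(_ erefl)[]] := Rbij _ _ r r'.
(* Otherwise the injection would extend to [A `|` A'], the new pairs being sent
   into [A']. *)
have noext A' : A' `<=` X `\` A -> A' !=set0 ->
    ~ ((A `|` A') `*` (A `|` A') #<= A').
  move=> A'X [a A'a] /pcard_leP/injfunPex[e eA' einj].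
  pose S : set (T * T * T) := R `|` [set p |
    [/\ ((A `|` A') `*` (A `|` A')) p.1, ~ (A `*` A) p.1 & p.2 = e p.1]].
  have nA x : A' x -> ~ A x by move=> /A'X[].
  have RA p : R p -> [/\ A p.1.1, A p.1.2 & A p.2].
    by case: p => -[x y] z /Rfld.
  have fldE x : fld S x <-> (A `|` A') x.
    split=> [[z [/RA[/= Ax _ _]|[[/= ? _]]]]|Ax]; [by left | by [] |].
    have [Ax'|nAx] := pselect (A x); first by case: Ax' => z ?; exists z; left.
    by exists (e (x, x)); right; split=> //= -[].
  apply: (maxR S).
    split; first by move=> p; left.
    move=> SR; have /SR/RA[/= /(nA _ A'a)//] : S (a, a, e (a, a)).
    by right; split=> //=; [split; right | move=> [/(nA _ A'a)]].
  split.
  - by move=> x /fldE[/RX//|/A'X[]].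
  - move=> x y z [/RA[/= ? ? ?]|[/= Axy _ ->]].
      by split; apply/fldE; left.
    by split; apply/fldE; [case: Axy..|right; apply: eA'].
  - move=> x y /fldE Ax /fldE Ay; have [[Ax' Ay']|nA2] := pselect ((A `*` A) (x, y)).
      by have [z ?] := Rtot x y Ax' Ay'; exists z; left.
    by exists (e (x, y)); right.
  - move=> p q [Rp|[p1 np p2]] [Rq|[q1 nq q2]]; first exact: Rbij.
    + have [pA pA' pA2] := RA p Rp; split=> pq.
        by case: nq; rewrite -pq.
      by case: (nA p.2) => //; rewrite pq q2; apply: eA'.
    + have [qA qA' qA2] := RA q Rq; split=> pq.
        by case: np; rewrite pq.
      by case: (nA q.2) => //; rewrite -pq p2; apply: eA'.
    + have pq : p.1 = q.1 -> p = q.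
        by case: p q {p1 q1 np nq} p2 q2 => [? ?] [? ?] /= -> -> ->.
      split=> // epq; apply: pq; apply: einj; rewrite ?inE //.
      by rewrite -p2 -q2.
have bool_le U (B : set U) : infinite_set B -> [set: bool] #<= B.
  by move=> /infiniteP; apply: card_le_trans; apply: countableP.
(* For finite [A], a countably infinite subset of the complement serves as [A']: the enlarged set is
   countable, and so is its square. *)
have [finA|infA] := pselect (finite_set A).
  have /infiniteP/pcard_leP[f] : infinite_set (X `\` A) by apply: infinite_setD.
  have cA' : range f #= [set: nat] by apply: card_image.
  case: (noext (range f)).
  - by move=> _ [n _ <-]; apply: funS.
  - by exists (f 0%N), 0%N.
  have cU : countable (A `|` range f).
    rewrite -bigcup2E; apply: bigcup_countable; first exact: countableP.
    move=> [|[|i]] _ /=; last exact: countable0.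
      exact: finite_set_countable.
    by rewrite (eq_countable cA').
  rewrite (card_le_eqr cA'); exact: countableX.
have le_absorb U (B : set U) :
    B #<= A `*` A -> B #<= A by move=> h; exact: card_le_trans h AA.
have AUA U (B C : set U) : B #<= A -> C #<= A -> B `|` C #<= A.
  move=> BA CA; apply: le_absorb; apply: card_le_trans (card_leU BA CA) _.
  by apply: card_leX => //; apply: bool_le.
(* Either the complement of [A] is absorbed, so that [X] is no larger than [A], or it contains a
   copy of [A], which serves as [A']. *)
have [leA|leD] := card_le_total A (X `\` A); last first.
  have XA : X #<= A.
    rewrite -(setDUK RX); exact: AUA.
  apply: card_le_trans (card_leX XA XA) _.
  exact: card_le_trans AA (subset_card_le RX).
have /pcard_leP[f] := leA.
have cA' : f @` A #= A by apply: card_image.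
case: (noext (f @` A)).
- by move=> _ [n An <-]; apply: funS.
- by have [a Aa] := infinite_setN0 infA; exists (f a), a.
rewrite (card_le_eqr cA'); apply: le_absorb.
by apply: card_leX; apply: AUA => //; apply: card_image_le.
Qed.

(** * Sets smaller than a given infinite set *)

Lemma not_card_le_finite (T U : Type) (A : set T) (B : set U) :
  infinite_set B -> finite_set A -> ~ (B #<= A).
Proof. by move=> infB finA BA; apply: infB; apply: card_le_finite BA finA. Qed.

Lemma not_card_le_image (T T' U : Type) (f : T -> T') (A : set T) (B : set U) :
  ~ (B #<= A) -> ~ (B #<= f @` A).
Proof.
by move=> nBA BA; apply: nBA; apply: card_le_trans BA (card_image_le f A).
Qed.

(** The product embeds in the square of the larger factor, which is finite or equipotent with that
    factor. *)
Lemma not_card_leX (T T' U : Type) (A : set T) (A' : set T') (B : set U) :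
  infinite_set B -> ~ (B #<= A) -> ~ (B #<= A') -> ~ (B #<= A `*` A').
Proof.
move=> infB nA nA'.
have dominated V W (C : set V) (D : set W) : C #<= D -> ~ (B #<= D) ->
    forall E : set (V * W), E #<= D `*` D -> ~ (B #<= E).
  move=> CD nD E ED BE; have [finD|infD] := pselect (finite_set D).
    exact: not_card_le_finite infB (finite_setX finD finD) (card_le_trans BE ED).
  by apply: nD; apply: card_le_trans (card_le_trans BE ED) (card_le_setXX infD).
have [AA'|A'A] := card_le_total A A'.
  exact: dominated AA' nA' _ (card_leX AA' (card_lexx _)).
move=> BAA'; have := dominated _ _ _ _ A'A nA (A' `*` A).
apply; first exact: card_leX.
apply: card_le_trans BAA' _.
apply: (@card_le_rel _ _ _ _ (fun p q => q = (p.2, p.1))).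
  by move=> [x y] [? ?]; exists (y, x).
by move=> [x y] [x' y'] [u v] _ _ /= [-> ->] [-> ->].
Qed.

Lemma not_card_leU (T U : Type) (A A' : set T) (B : set U) :
  infinite_set B -> ~ (B #<= A) -> ~ (B #<= A') -> ~ (B #<= A `|` A').
Proof.
move=> infB nA nA' BAA'; have [C [nC AC AC']] :
    exists C : set T, [/\ ~ (B #<= C), A #<= C & A' #<= C].
  by have [AA'|A'A] := card_le_total A A'; [exists A' | exists A].
have finbool : finite_set [set: bool] by apply: finite_finset.
apply: (not_card_leX infB nC (not_card_le_finite infB finbool)).
exact: card_le_trans BAA' (card_leU AC AC').
Qed.

(** * Well orders with small initial segments *)

(** If some initial segment of a well order is as large as [T], take the least [t] bounding such a
    segment and pull the order back along an injection of [T] into the segment below [t]. The new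
    segments embed in segments below points smaller than [t], hence are small. *)
Lemma initial_well_order (T : Type) : exists R : T -> T -> Prop,
  [/\ well_founded R, forall x y, [\/ R x y, x = y | R y x] &
      forall t, ~ ([set: T] #<= [set s | R s t])].
Proof.
have [S [wfS totS]] : exists S : T -> T -> Prop,
    well_founded S /\ forall x y, [\/ S x y, x = y | S y x].
  elim/Peq: T => T; have [R woR] := well_ordering_principle T.
  have Rmin (A : set T) : A !=set0 -> exists2 z, A z & forall x, A x -> R z x.
    move=> [x Ax]; have [|z [[/asboolP Az lbz] _]] := woR (fun x => `[< A x >]).
      by exists x; apply/asboolP.
    by exists z => // y Ay; apply: lbz; apply/asboolP.
  have Rxx x : R x x.
    by have [|z ->] := Rmin [set x]; [exists x | apply].
  have Rtot x y : R x y \/ R y x.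
    have [|z [->|->] h] := Rmin [set x; y]; first by exists x; left.
      by left; apply: h; right.
    by right; apply: h; left.
  have Ranti x y : R x y -> R y x -> x = y.
    move=> Rxy Ryx; have [|z [_ uz]] := woR (fun t => `[< [set x; y] t >]).
      by exists x; apply/asboolP; left.
    have <- : z = x.
      apply: uz; split; first by apply/asboolP; left.
      by move=> t /asboolP[->|->].
    apply: uz; split; first by apply/asboolP; right.
    by move=> t /asboolP[->|->].
  (* The strict part of [R] is well founded, since the set of inaccessible points would have an
     [R]-least element. *)
  exists (fun x y => R x y /\ x <> y); split; last first.
    move=> x y; have [xy|xy] := pselect (x = y); first exact: Or32.
    by have [?|?] := Rtot x y; [apply: Or31|apply: Or33]; split=> // /esym.
  move=> x; apply: contrapT => nx.
  have [|z nz zmin] := Rmin [set x | ~ Acc (fun x y => R x y /\ x <> y) x].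
    by exists x.
  apply: nz; apply: Acc_intro => y [Ryz yz]; apply: contrapT => ny.
  by apply: yz; apply: Ranti => //; apply: zmin.
have [|/existsNP[t0 /contrapT bigt0]] :=
    pselect (forall t, ~ ([set: T] #<= [set s | S s t])); first by exists S.
have {bigt0} [t bigt mint] : exists2 t, [set: T] #<= [set s | S s t] &
    forall u, S u t -> ~ ([set: T] #<= [set s | S s u]).
  elim: (wfS t0) bigt0 => {}t0 _ IH bigt0.
  have [h|/existsNP[u /not_implyP[ut /contrapT]]] :=
    pselect (forall u, S u t0 -> ~ ([set: T] #<= [set s | S s u])).
    by exists t0.
  exact: IH.
elim/Ppointed: T => T in S t0 wfS totS t bigt mint *.
  by have := no t.
have /pcard_leP/injfunPex[f ft finj] := bigt.
exists (fun x y => S (f x) (f y)); split.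
- move=> x; have [u] : exists u, f x = u by exists (f x).
  elim: (wfS u) x => {}u _ IH x fx; apply: Acc_intro => y; rewrite fx => Syu.
  exact: IH Syu _ erefl.
- move=> x y; have [?|/finj|?] := totS (f x) (f y).
  + exact: Or31.
  + by move=> h; apply: Or32; apply: h; rewrite inE.
  + exact: Or33.
- move=> x le; apply: (mint (f x)); first exact: ft.
  apply: card_le_trans le _; apply: (@card_le_rel _ _ _ _ (fun u v => v = f u)).
    by move=> u Sux; exists (f u).
  by move=> u u' v _ _ -> /finj; apply; rewrite inE.
Qed.

(** * Transfinite construction *)

(* Being a condition on quadruples makes it pass to unions of chains. *)
Definition quad_closed (H : Type) (Q : H -> H -> H -> H -> Prop) (X : set H) :=
  forall x y z w, X x -> X y -> X z -> X w -> Q x y z w.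

(** Stage [t] adds a pair meeting [Req t] to all points added earlier. These are at most two for
    each [s] below [t], so they form a set smaller than [T] and [ext] applies. *)
Lemma transfinite_pairs (T H : Type) (Q : H -> H -> H -> H -> Prop)
    (Req : T -> H -> H -> Prop) :
  infinite_set [set: T] ->
  (forall t (X : set H), ~ ([set: T] #<= X) -> quad_closed Q X ->
     exists p q, quad_closed Q (X `|` [set p; q]) /\ Req t p q) ->
  exists2 P : set H, quad_closed Q P &
    forall t, exists p q, [/\ P p, P q & Req t p q].
Proof.
move=> infT ext; have [R [wfR totR smallR]] := initial_well_order T.
have transR x y z : R x y -> R y z -> R x z.
  move=> Rxy Ryz; apply: contrapT => nRxz.
  have xz : x = z \/ R z x by case: (totR x z) => // ?; [left|right].
  (* Otherwise each of [x], [y], [z] would have a predecessor among the three, against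
     well-foundedness. *)
  have no_desc u : ~ [set x; y; z] u.
    elim: (wfR u) => {}u _ IH [[|]|] eu; rewrite eu in IH.
    - case: xz => [xz|zx]; last by apply: (IH z zx); right.
      by apply: (IH y); [rewrite xz|left; right].
    - by apply: (IH x Rxy); left; left.
    - by apply: (IH y Ryz); left; right.
  by apply: (no_desc x); left; left.
have /choice[c cP] : forall tX : T * set H, exists pq : H * H,
    ~ ([set: T] #<= tX.2) -> quad_closed Q tX.2 ->
    quad_closed Q (tX.2 `|` [set pq.1; pq.2]) /\ Req tX.1 pq.1 pq.2.
  move=> [t X] /=; have [[h1 h2]|h] := pselect (~ ([set: T] #<= X) /\ quad_closed Q X).
    by have [p [q pqP]] := ext t X h1 h2; exists (p, q).
  (* A default value for inadmissible inputs: [H] is inhabited because [ext] extends the empty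
     set. *)
  have [p _] : [set: H] !=set0.
    have [||p [q _]] := ext t set0; [|by []|by exists p].
    by apply: not_card_le_finite => //; apply: finite_set0.
  by exists (p, p) => h1 h2; case: h.
pose below t (rec : forall s, R s t -> H * H) : set H :=
  [set h | exists s (Rst : R s t), h = (rec s Rst).1 \/ h = (rec s Rst).2].
pose f := Fix wfR (fun=> (H * H)%type) (fun t rec => c (t, below t rec)).
pose X t := [set h | exists2 s, R s t & h = (f s).1 \/ h = (f s).2].
have fE t : f t = c (t, X t).
  rewrite /f Fix_eq.
    congr (c (_, _)); apply/seteqP; split=> h.
      by move=> [s [Rst hs]]; exists s.
    by move=> [s Rst hs]; exists s, Rst.
  move=> u g g' gg'; congr (c (_, below _ _)).
  by apply: functional_extensionality_dep => s; apply: functional_extensionality_dep.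
have smallX t : ~ ([set: T] #<= X t).
  have -> : X t = (fun sb : T * bool => if sb.2 then (f sb.1).1 else (f sb.1).2)
      @` ([set s | R s t] `*` [set: bool]).
    apply/seteqP; split=> h.
      by move=> [s Rst [->|->]]; [exists (s, true) | exists (s, false)].
    by move=> [[s []] [/= Rst _] <-]; exists s => //; [left|right].
  apply: not_card_le_image; apply: not_card_leX => //.
  by apply: not_card_le_finite => //; apply: finite_finset.
pose Y t := X t `|` [set (f t).1; (f t).2].
have YE t h : Y t h <-> exists2 s, s = t \/ R s t & h = (f s).1 \/ h = (f s).2.
  split=> [[[s ? ?]|?]|[s [->|?] ?]].
  - by exists s => //; right.
  - by exists t => //; left.
  - by right.
  - by left; exists s.
have Ymon s t : s = t \/ R s t -> Y s `<=` Y t.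
  move=> [->//|Rst] h /YE[u us hu]; apply/YE; exists u => //.
  by case: us => [->|us]; right => //; apply: transR Rst.
have Ymax s t : exists2 u, Y s `<=` Y u /\ Y t `<=` Y u & u = s \/ u = t.
  have [st|->|ts] := totR s t.
  - by exists t; [split; apply: Ymon; [right|left]|right].
  - by exists t; [split; apply: Ymon; left|right].
  - by exists s; [split; apply: Ymon; [left|right]|left].
(* The stages form a chain, so four points from four stages lie together in one of these same
   stages. *)
have Ymax4 s1 s2 s3 s4 : exists2 u,
    [/\ Y s1 `<=` Y u, Y s2 `<=` Y u, Y s3 `<=` Y u & Y s4 `<=` Y u] &
    [\/ u = s1, u = s2, u = s3 | u = s4].
  have [a [a1 a2] ea] := Ymax s1 s2; have [b [b3 b4] eb] := Ymax s3 s4.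
  have [u [ua ub] eu] := Ymax a b; exists u.
    by split; [move: a1|move: a2|move: b3|move: b4] => /subset_trans; apply.
  by case: eu => ->; [case: ea|case: eb] => ->;
    [exact: Or41|exact: Or42|exact: Or43|exact: Or44].
have union (D : set T) : (forall t, D t -> quad_closed Q (Y t)) ->
    quad_closed Q (\bigcup_(t in D) Y t).
  move=> QD x y z w [s1 D1 x1] [s2 D2 y2] [s3 D3 z3] [s4 D4 w4].
  have [u [h1 h2 h3 h4] eu] := Ymax4 s1 s2 s3 s4.
  have Du : D u by case: eu => ->.
  by apply: (QD u) => //; [exact: h1|exact: h2|exact: h3|exact: h4].
have YP t : quad_closed Q (Y t) /\ Req t (f t).1 (f t).2.
  elim: (wfR t) => {}t _ IH; rewrite /Y fE; apply: (cP (t, X t)) => //=.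
  have -> : X t = \bigcup_(s in [set s | R s t]) Y s.
    apply/seteqP; split=> h.
      by move=> [s Rst hs]; exists s => //; apply/YE; exists s => //; left.
    move=> [s Rst /YE[u us hu]]; exists u => //.
    by case: us => [->|us] //; apply: transR Rst.
  by apply: union => s /IH[].
exists (\bigcup_(t in [set: T]) Y t); first by apply: union => t _; apply: (YP t).1.
move=> t; exists (f t).1, (f t).2.
by split; [exists t => //; right; left|exists t => //; right; right|exact: (YP t).2].
Qed.

(** * Sidon sets in a product *)

Local Open Scope ring_scope.

(** The clauses on fewer points are padded to quadruples, so that one closure condition carries all
    invariants: first coordinates in [I], a functional and injective graph, and uniqueness of
    nonzero differences. *)
Definition sidon_quad (F V : zmodType) (I : set F) (x y z w : F * V) : Prop :=
  [/\ I x.1, x.1 = y.1 -> x = y, x.2 = y.2 -> x = y &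
      x + w = y + z -> x = y \/ x = z].

Lemma quad_closedS (H : Type) (Q : H -> H -> H -> H -> Prop) (X Y : set H) :
  X `<=` Y -> quad_closed Q Y -> quad_closed Q X.
Proof. by move=> XY QY x y z w *; apply: QY; apply: XY. Qed.

(** In [x + w = y + z], occurrences of [p] on both sides cancel and leave a trivial solution;
    occurrences on one side only are the two excluded equations. *)
Lemma sidon_add1 (F V : zmodType) (I : set F) (X : set (F * V)) (p : F * V) :
  quad_closed (sidon_quad I) X -> I p.1 ->
  (forall x, X x -> p.1 <> x.1 /\ p.2 <> x.2) ->
  (forall x y z, X x -> X y -> X z -> p + x <> y + z) ->
  (forall x y, X x -> X y -> p + p <> x + y) ->
  quad_closed (sidon_quad I) (X `|` [set p]).
Proof.
move=> QX Ip np p1 p2 x y z w Xx Xy Xz Xw; split.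
- by case: Xx => [Xx|->] //; case: (QX x x x x).
- case: Xx Xy => [Xx|->] [Xy|->] //; first by case: (QX x y x x).
    by move=> /esym e; case: (np x Xx).
  by move=> e; case: (np y Xy).
- case: Xx Xy => [Xx|->] [Xy|->] //; first by case: (QX x y x x).
    by move=> /esym e; case: (np x Xx).
  by move=> e; case: (np y Xy).
case: Xx Xw => [Xx|->] [Xw|->].
- case: Xy Xz => [Xy|->] [Xz|->].
  + by case: (QX x y z w).
  + by rewrite [y + p]addrC => /esym /p1; case.
  + by move=> /esym /p1; case.
  + by move=> /esym /p2; case.
- case: Xy Xz => [Xy|->] [Xz|->].
  + by rewrite addrC => /p1; case.
  + by move=> /addIr ->; left.
  + by rewrite addrC => /addrI ->; right.
  + by move=> /addIr ->; left.
- case: Xy Xz => [Xy|->] [Xz|->]; try by [left|right].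
  by move=> /p1; case.
- case: Xy Xz => [Xy|->] [Xz|->]; try by [left|right].
  by move=> /p2; case.
Qed.

(** Add [p], then [p + delta]. Solving each new relation for [p] or [p + p] leaves a multiple of
    [delta] as offset: none for [p] alone, minus one or two for each use of [p + delta], plus one
    for [p + delta + x = p + p]. These offsets form [C]. *)
Lemma sidon_add2 (F V : zmodType) (I : set F) (X : set (F * V))
    (p delta : F * V) (C := [set 0; delta; - delta; - delta - delta]) :
  quad_closed (sidon_quad I) X -> I p.1 -> I (p + delta).1 ->
  delta.1 + delta.1 <> 0 -> delta.2 <> 0 ->
  (forall u, X u -> ~ X (u + delta)) ->
  (forall u v w c, X u -> X v -> X w -> C c ->
     p.1 <> (u + v - w + c).1 /\ p.2 <> (u + v - w + c).2) ->
  (forall u v c, X u -> X v -> C c -> p.1 + p.1 <> (u + v + c).1) ->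
  quad_closed (sidon_quad I) (X `|` [set p; p + delta]).
Proof.
move=> QX Ip Iq d2 g0 ndelta nB nD.
have d1 : delta.1 <> 0 by move=> d0; apply: d2; rewrite d0 addr0.
have dd0 : delta + delta <> 0 by move=> /(congr1 fst).
have C0 : C 0 by left; left; left.
have C1 : C delta by left; left; right.
have C2 : C (- delta) by left; right.
have C3 : C (- delta - delta) by right.
have nB1 u c : X u -> C c -> p.1 <> (u + c).1 /\ p.2 <> (u + c).2.
  by move=> Xu Cc; have := nB u u u c Xu Xu Xu Cc; rewrite addrK.
have nBp u v w c : X u -> X v -> X w -> C c -> p <> u + v - w + c.
  by move=> Xu Xv Xw Cc e; have [] := nB _ _ _ _ Xu Xv Xw Cc; rewrite -e.
have nB1p u c : X u -> C c -> p <> u + c.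
  by move=> Xu Cc e; have [] := nB1 _ _ Xu Cc; rewrite -e.
have nDp u v c : X u -> X v -> C c -> p + p <> u + v + c.
  by move=> Xu Xv Cc e; have [] := nD _ _ _ Xu Xv Cc; rewrite -e.
rewrite setUA; apply: sidon_add1 => //.
- apply: sidon_add1 => //.
  + by move=> x Xx; rewrite -[x]addr0; apply: nB1.
  + move=> x y z Xx Xy Xz e; apply: (nBp y z x 0) => //.
    by rewrite -e addrK addr0.
  + by move=> x y Xx Xy; rewrite -[x + y]addr0; apply: nDp.
- move=> x [Xx|->].
    have [n1 n2] := nB1 _ _ Xx C2.
    by split=> e; [apply: n1|apply: n2]; rewrite /= -e addrK.
  split=> e; [apply: d1; apply: (addrI p.1)|apply: g0; apply: (addrI p.2)].
    by rewrite addr0.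
  by rewrite addr0.
- move=> x y z [Xx|->] [Xy|->] [Xz|->] e.
  + by apply: (nBp _ _ _ _ Xy Xz Xx C2); rewrite -e !addrK.
  (* After cancelling [p], [delta] would already be a difference within [X]. *)
  + apply: (ndelta x Xx); suff -> : x + delta = y by [].
    by apply: (addIr p); rewrite -e addrC [x + delta]addrC addrA.
  + apply: (ndelta x Xx); suff -> : x + delta = z by [].
    by apply: (addrI p); rewrite -e addrA addrAC.
  + apply: (nB1p _ _ Xx C1); apply: (addrI p).
    by rewrite -e addrA addrAC.
  + apply: (nDp _ _ _ Xy Xz C2).
    by rewrite -e addrAC addrK.
  + apply: (nB1p _ _ Xy C2).
    by rewrite -(addIr _ e) addrK.
  + apply: (nB1p _ _ Xz C2).
    by rewrite addrC in e; rewrite -(addrI _ e) addrK.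
  + apply: d1; rewrite (_ : delta = 0) //; apply: (addrI p).
    by rewrite addr0; exact: addIr e.
- move=> x y [Xx|->] [Xy|->] e.
  + apply: (nDp _ _ _ Xx Xy C3).
    by rewrite -e addrA addrA addrK addrAC addrK.
  + apply: (nB1p _ _ Xx C3); rewrite (_ : x = p + delta + delta).
      by rewrite addrA !addrK.
    by apply: (addIr p); rewrite -e -[RHS]addrA [delta + p]addrC.
  + apply: (nB1p _ _ Xy C3); rewrite (_ : y = p + delta + delta).
      by rewrite addrA !addrK.
    by apply: (addrI p); rewrite -e addrCA.
  + by apply: dd0; apply: (addrI (p + p)); rewrite addrACA e addr0.
Qed.

(** * Choosing new points *)

(** The forbidden values of [i] and of [i + i] are images of products of sets smaller than [B]. As
    doubling is injective on [J], both conditions together exclude fewer than [B] elements of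
    [J]. *)
Lemma exists_fresh (T : Type) (H K : zmodType) (phi : H -> K) (B : set T)
    (J : set K) (X C : set H) :
  infinite_set B -> B #<= J -> ~ (B #<= X) -> finite_set C ->
  {in J &, injective (fun i => i + i)} ->
  exists i, [/\ J i,
    forall u v w c, X u -> X v -> X w -> C c -> i <> phi (u + v - w + c) &
    forall u v c, X u -> X v -> C c -> i + i <> phi (u + v + c)].
Proof.
move=> infB BJ nX finC dblJ.
have nC : ~ (B #<= C) := not_card_le_finite infB finC.
pose S := (fun q : H * H * H * H => phi (q.1.1.1 + q.1.1.2 - q.1.2 + q.2))
  @` (X `*` X `*` X `*` C).
pose D := (fun q : H * H * H => phi (q.1.1 + q.1.2 + q.2)) @` (X `*` X `*` C).
have nS : ~ (B #<= S) by apply: not_card_le_image; do !apply: not_card_leX => //.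
have nD : ~ (B #<= D) by apply: not_card_le_image; do !apply: not_card_leX => //.
have nDJ : ~ (B #<= [set i | J i /\ D (i + i)]).
  move=> le; apply: nD; apply: card_le_trans le _.
  apply: (@card_le_rel _ _ _ _ (fun i j => j = i + i)).
    by move=> i [_ Di]; exists (i + i).
  by move=> i i' j [Ji _] [Ji' _] -> /dblJ; apply; rewrite inE.
have [i [Ji nSi nDi]] : exists i, [/\ J i, ~ S i & ~ D (i + i)].
  apply: contrapT => nex; apply: (not_card_leU infB nS nDJ).
  apply: card_le_trans BJ (subset_card_le _) => i Ji.
  have [|nSi] := pselect (S i); first by left.
  have [Di|nDi] := pselect (D (i + i)); first by right.
  by case: nex; exists i.
exists i; split=> // [u v w c Xu Xv Xw Cc e|u v c Xu Xv Cc e].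
  by apply: nSi; exists (u, v, w, c).
by apply: nDi; exists (u, v, c).
Qed.

(** A requirement that [X] already meets needs no new point. Otherwise the free coordinates are
    chosen fresh: in [V] from [J], in [F] from [I], or from the shift set of [d] when [d] must
    become a difference. *)
Lemma sidon_realize (F V : zmodType) (I : set F) (J : set V) (X : set (F * V)) :
  infinite_set [set: V] -> [set: V] #<= I -> [set: V] #<= J ->
  injective (fun i : F => i + i) -> {in J &, injective (fun v => v + v)} ->
  ~ ([set: V] #<= X) -> quad_closed (sidon_quad I) X ->
  [/\ forall i, I i -> exists2 p, quad_closed (sidon_quad I) (X `|` [set p]) & p.1 = i,
      forall v, exists2 p, quad_closed (sidon_quad I) (X `|` [set p]) & p.2 = v &
      forall d v, d <> 0 -> v <> 0 -> [set: V] #<= [set i | I i /\ I (i + d)] ->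
        exists p, quad_closed (sidon_quad I) (X `|` [set p; p + (d, v)])].
Proof.
move=> infV VI VJ dblF dblJ nX QX; split.
- move=> i Ii.
  have [[x Xx xi]|ni] := pselect (exists2 x, X x & x.1 = i).
    by exists x => //; apply: quad_closedS QX => y [//|->].
  have [v [Jv nS nD]] := exists_fresh snd infV VJ nX (finite_set1 0) dblJ.
  exists (i, v) => //; apply: sidon_add1 => //=.
  + move=> x Xx; split=> e; first by apply: ni; exists x.
    by apply: (nS x x x 0) => //; rewrite addrK addr0.
  + move=> x y z Xx Xy Xz e; apply: (nS y z x 0) => //.
    by rewrite addr0 -e addrK.
  + move=> x y Xx Xy e; apply: (nD x y 0) => //.
    by rewrite addr0 -e.
- move=> v.
  have [[x Xx xi]|ni] := pselect (exists2 x, X x & x.2 = v).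
    by exists x => //; apply: quad_closedS QX => y [//|->].
  have [i [Ii nS nD]] :=
    exists_fresh fst infV VI nX (finite_set1 0) (in2W dblF).
  exists (i, v) => //; apply: sidon_add1 => //=.
  + move=> x Xx; split=> e; last by apply: ni; exists x.
    by apply: (nS x x x 0) => //; rewrite addrK addr0.
  + move=> x y z Xx Xy Xz e; apply: (nS y z x 0) => //.
    by rewrite addr0 -e addrK.
  + move=> x y Xx Xy e; apply: (nD x y 0) => //.
    by rewrite addr0 -e.
- move=> d v d0 v0 VId.
  have [[x [Xx Xxd]]|nd] := pselect (exists x, X x /\ X (x + (d, v))).
    by exists x => //; apply: quad_closedS QX => y [//|[->|->]].
  pose delta : F * V := (d, v).
  pose C := [set 0; delta; - delta; - delta - delta].
  have finC : finite_set C by apply: finite_set4.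
  have [i [[Ii Iid] nS nD]] := exists_fresh fst infV VId nX finC (in2W dblF).
  have [w [Jw nS' _]] := exists_fresh snd infV VJ nX finC dblJ.
  exists (i, w) => //; apply: sidon_add2 => //=.
  + by move=> dd; apply: d0; apply: dblF; rewrite dd addr0.
  + by move=> u Xu Xud; apply: nd; exists u.
  + by move=> x y z c *; split; [apply: nS | apply: nS'].
Qed.

(** * From Sidon sets to terraces *)

Lemma zmod_terrace (V : zmodType) (F : realFieldType) (I : set F) :
  infinite_set [set: V] -> [set v + v | v in [set: V]] #= [set: V] ->
  index_set I -> I #= [set: V] ->
  exists P : set (F * V), quad_closed (sidon_quad I) P /\
    [/\ forall i, I i -> exists v, P (i, v), forall v, exists i, P (i, v) &
        forall d v, 0 < d -> shift_set I d <> set0 -> v <> 0 ->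
          exists2 p, P p & P (p + (d, v))].
Proof.
move=> infV sqV [IF shiftI] IV.
have FV : [set: F] #= [set: V] by apply: card_eq_trans IV; apply: card_esym.
(* [J] contains one chosen half of every double; by squarefulness there are as many doubles as
   elements of [V]. *)
have [J VJ dblJ] : exists2 J : set V, [set: V] #<= J &
    {in J &, injective (fun v => v + v)}.
  have /choice[s sP] : forall y : V, exists x, (exists x, x + x = y) -> x + x = y.
    move=> y; have [[x xy]|n] := pselect (exists x, x + x = y); first by exists x.
    by exists 0 => h; case: n.
  exists (s @` [set v + v | v in [set: V]]); last first.
    move=> _ _ /set_mem[_ [x _ <-] <-] /set_mem[_ [y _ <-] <-] /=.
    by rewrite sP; [rewrite sP; [move=> ->|exists y]|exists x].
  move: sqV => /card_eqPle[_ VS]; apply: card_le_trans VS _.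
  apply: (@card_le_rel _ _ _ _ (fun y x => x + x = y)).
    move=> _ [x _ <-]; exists (s (x + x)); last by apply: sP; exists x.
    by exists (x + x) => //; exists x.
  by move=> x x' y _ _ <- <-.
have dblF : injective (fun i : F => i + i).
  move=> i j /= e; apply: (mulfI (x := 2%:R)); first by rewrite pnatr_eq0.
  by rewrite !mulr_natl !mulr2n.
pose T := (nat * (F * V))%type.
(* With no more tasks than elements of [V], a set smaller than the set of tasks is also smaller than
   [V]. *)
have TV : [set: T] #<= [set: V].
  have VV : [set: V] `*` [set: V] #<= [set: V] by apply: card_le_setXX.
  rewrite -!setXTT; apply: card_le_trans (VV); apply: card_leX; first exact/infiniteP.
  apply: card_le_trans (VV); apply: card_leX => //.
  by have /card_eqPle[] := FV.
have infT : infinite_set [set: T].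
  apply/infiniteP; apply: (@card_le_rel _ _ _ _ (fun n t => t = (n, 0))).
    by move=> n _; exists (n, 0).
  by move=> n n' t _ _ -> [].
(* Tasks: (0, (i, _)) puts i in the domain, (1, (_, v)) puts v in the range,
   the others make (d, v) a difference. *)
pose Req (t : T) (p q : F * V) : Prop :=
  match t with
  | (0%N, (i, _)) => I i -> p.1 = i
  | (1%N, (_, v)) => p.2 = v
  | (_, (d, v)) => 0 < d -> shift_set I d <> set0 -> v <> 0 -> q = p + (d, v)
  end.
have [|P QP PReq] := @transfinite_pairs T (F * V) (sidon_quad I) Req infT.
  move=> t X nTX QX.
  have nX : ~ ([set: V] #<= X) by move=> le; apply: nTX; apply: card_le_trans TV le.
  have VI : [set: V] #<= I by have /card_eqPle[] := IV.
  have [dom ran diff] := sidon_realize infV VI VJ dblF dblJ nX QX.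
  have pad p : X `|` [set p; p] = X `|` [set p] by rewrite setUid.
  (* Tasks whose premises fail are met by any admissible extension. *)
  have triv : exists p q, quad_closed (sidon_quad I) (X `|` [set p; q]).
    by have [p Qp _] := ran 0; exists p, p; rewrite pad.
  case: t => -[|[|n]] [d v] /=.
  - have [Id|nId] := pselect (I d).
      by have [p Qp pd] := dom d Id; exists p, p; rewrite pad.
    by have [p [q Qpq]] := triv; exists p, q.
  - by have [p Qp pv] := ran v; exists p, p; rewrite pad.
  - have [[d0 Id v0]|nreq] :=
      pselect [/\ 0 < d, shift_set I d <> set0 & v <> 0]; last first.
      by have [p [q Qpq]] := triv; exists p, q; split=> // *; case: nreq.
    have [||p Qp] := diff d v _ v0; last by exists p, (p + (d, v)).
        by move=> d00; rewrite d00 ltxx in d0.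
    (* A nonempty shift set of an index set has the cardinality of [F], leaving enough choices for
       the first coordinate. *)
    have [/card_eqPle[_ le]|//] := shiftI d d0.
    by apply: card_le_trans le; have /card_eqPle[] := FV.
exists P; split=> //; split.
- move=> i Ii; have [[j v] [q [Pp Pq /= /(_ Ii) ij]]] := PReq (0%N, (i, 0)).
  by exists v; rewrite -ij.
- by move=> v; have [[i w] [q [Pp Pq /= <-]]] := PReq (1%N, (0, v)); exists i.
- move=> d v d0 Id v0; have [p [q [Pp Pq /= pq]]] := PReq (2%N, (d, v)).
  by exists p => //; rewrite -pq.
Qed.

Theorem theorem2p2 (G : groupType) (infG : infinite_set [set: G])
    (abG : abelian_group G) (sqG : squareful G)
    (F : realFieldType) (I : set F) (idxI : index_set I)
    (cardI : I #= [set: G]) :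
  exists a : F -> G, directed_terrace I a.
Proof.
(* [G] in additive notation with the same operations, so that [step] unfolds to a difference by
   conversion. *)
pose V : zmodType := HB.pack_for zmodType G (GRing.isZmodule.Build G
  (@mulgA G) abG (@mul1g G) (@mulVg G)).
have [P [QP [domP ranP diffP]]] := @zmod_terrace V F I infG sqG.2 idxI cardI.
have /choice[a aP] : forall i, exists v : V, I i -> P (i, v).
  move=> i; have [Ii|nIi] := pselect (I i); last by exists 0.
  by have [v Pv] := domP i Ii; exists v.
have PI i v : P (i, v) -> I i by move=> Pp; case: (QP _ _ _ _ Pp Pp Pp Pp).
have Pa i v : P (i, v) -> v = a i.
  move=> Pp; have Ii := PI _ _ Pp; have Pa := aP i Ii.
  by case: (QP _ _ _ _ Pp Pa Pa Pa) => _ /(_ erefl)[].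
have stepE d i : step (a : F -> G) d i = - a i + a (i + d) :> V by [].
exists (a : F -> G); split.
  split=> // [i j /set_mem Ii /set_mem Ij aij|v _].
    have := QP _ _ _ _ (aP i Ii) (aP j Ij) (aP j Ij) (aP j Ij).
    by move=> [_ _ /(_ aij)[]].
  by have [i Pi] := ranP v; exists i; [apply: PI Pi | rewrite -(Pa _ _ Pi)].
move=> d d0 Id.
have nd i : i <> i + d.
  by move/eqP; rewrite -subr_eq0 opprD addNKr oppr_eq0 gt_eqF.
split.
- move=> i [Ii Iid] /= e; apply: (nd i).
  have := QP _ _ _ _ (aP _ Ii) (aP _ Iid) (aP _ Ii) (aP _ Ii).
  (* A trivial step would give [i] and [i + d] the same value, against injectivity. *)
  move=> [_ _ /= h _]; have {h} [] // : (i, a i) = (i + d, a (i + d)).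
  by apply: h; apply: (addrI (- a i)); rewrite -stepE e addNr.
- move=> i j /set_mem[Ii Iid] /set_mem[Ij Ijd] e.
  (* Equal steps make the points over [i], [i + d], [j], [j + d] satisfy the Sidon equation. Its
     solutions are [i = i + d], which is impossible, and [i = j]. *)
  have := QP _ _ _ _ (aP _ Ii) (aP _ Iid) (aP _ Ij) (aP _ Ijd).
  move=> [_ _ _ []]; [|by case=> /nd|by case].
  apply: injective_projections => /=.
    by rewrite addrA addrAC.
  have eV : - a i + a (i + d) = - a j + a (j + d) :> V by [].
  have -> : a (i + d) = a i - a j + a (j + d) :> V by rewrite -addrA -eV addNKr.
  by rewrite addrAC subrK.
- move=> v v0; have [[i w] Pp Pq] := diffP d v d0 Id v0.
  exists i; first by split; [apply: PI Pp|apply: PI Pq].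
  by apply: etrans (stepE d i) _; rewrite -(Pa _ _ Pp) -(Pa _ _ Pq) /= addKr.
Qed.
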